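(* Let $B$ be a subset of a finite set $A$. Then $S_A \approx I_{B,A} \times S_{A \setminus B}$.
   Context: A set $E$ is finite if $\mathcal{P}(E)$ is the only subset $\mathcal{S}$ of the power set $\mathcal{P}(E)$ such that $\varnothing \in \mathcal{S}$ and $F \cup \{e\} \in \mathcal{S}$ whenever $F \in \mathcal{S}$, $F \neq E$ and $e \in E \setminus F$ (this is equivalent to the usual notion of finiteness). For sets $E,F$ write $E \approx F$ if there exists a bijective mapping $E \to F$. For a finite set $A$ and $B \subset A$ let $I_{B,A}$ be the set of injective mappings $k : B \to A$. For a finite set $C$ let $S_C$ be the set of bijections $h : C \to C$. *)

(* Defs.v *)
From mathcomp Require Import all_boot.
From mathcomp Require Import boolp classical_sets functions cardinality.

Set Implicit Arguments.
Unset Strict Implicit.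
Unset Printing Implicit Defensive.

Local Open Scope classical_set_scope.

(* Finiteness without reference to natural numbers: the power set of [E] is the
   only family of subsets of [E] that contains the empty set and is closed
   under adjoining an element of [E] to a member distinct from [E]. *)
Definition inductively_finite (T : Type) (E : set T) : Prop :=
  forall S : set (set T),
    S `<=` [set F | F `<=` E] ->
    S set0 ->
    (forall F e, S F -> F <> E -> (E `\` F) e -> S (F `|` [set e])) ->
    S = [set F | F `<=` E].

(* In the next two definitions [B], [A] and [C] are coerced to the types of
   their elements, so that [k] and [h] are functions defined on the set only,
   with no values outside it. *)
Definition injections (T : Type) (B A : set T) : set (B -> A) :=
  [set k : B -> A | injective k].
Arguments injections {T} B A _.

Definition bijections (T : Type) (C : set T) : set (C -> C) :=
  [set h : C -> C | bijective h].
Arguments bijections {T} C _.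

(* Main.v *)
Require Import Defs.
From mathcomp Require Import all_boot.
From mathcomp Require Import boolp classical_sets functions cardinality.

(** Restricting a permutation of [A] to [B] gives an injection [B -> A].  If
    every injection [k : B -> A] arises in this way, choose for each [k] one
    permutation [e k] of [A] that restricts to it.  The permutations [h] which
    restrict to [k] are then exactly the [e k \o g], where [g] is a permutation
    of [A] fixing [B] pointwise; such a [g] maps [A `\` B] onto itself, so it
    amounts to a permutation of [A `\` B].  Hence [(k, s) |-> e k \o (id + s)]
    is the required bijection ([bijections_sum]); this half of the argument
    holds for arbitrary sets.

    Finiteness is what makes injections extend to permutations
    ([injection_extends]).  This is proved by induction on the subset [F] of
    [A] on which the injection is given, directly from the induction principle
    that defines finiteness and without any counting: when one more point [e]
    is adjoined, a permutation that is correct on [F] is corrected at [e] by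
    composing it with a transposition of its value at [e] and the wanted value;
    both values lie outside the image of [F], so nothing changes on [F]. *)

Local Open Scope classical_set_scope.
Local Open Scope card_scope.

(** * Transpositions *)

Definition transposition {X : Type} (a b x : X) : X :=
  if pselect (x = a) then b else if pselect (x = b) then a else x.

Lemma transpositionL {X : Type} (a b : X) : transposition a b a = b.
Proof. by rewrite /transposition; case: pselect. Qed.

Lemma transpositionD {X : Type} (a b x : X) :
  x <> a -> x <> b -> transposition a b x = x.
Proof. by rewrite /transposition; case: pselect => //; case: pselect. Qed.

Lemma transpositionK {X : Type} (a b : X) : involutive (transposition a b).
Proof.
by move=> x; rewrite /transposition; do !case: pselect => //= ?; congruence.
Qed.

(** * Injections from a subset of a finite set extend to permutations *)

(** The injection is represented by a self-map of the whole of [A] of which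
    only the values on [F] matter, so that restricting it to a smaller subset
    in the induction needs no change of domain. *)
Lemma injective_on_extends {T : Type} {A F : set T} (f : A -> A) :
  inductively_finite A -> F `<=` A ->
  (forall x y : A, F (val x) -> F (val y) -> f x = f y -> x = y) ->
  exists2 h : A -> A, bijective h & forall x, F (val x) -> h x = f x.
Proof.
move=> finA FA.
pose extends (G : set T) := forall f : A -> A,
  (forall x y : A, G (val x) -> G (val y) -> f x = f y -> x = y) ->
  exists2 h : A -> A, bijective h & forall x, G (val x) -> h x = f x.
suff E : [set G | G `<=` A /\ extends G] = [set G | G `<=` A].
  have : [set G | G `<=` A] F by [].
  by rewrite -E => -[_]; apply.
apply: finA => [G []//||G e [GA extG] _ [Ae nGe]].
  by split=> // g _; exists id => //; exists id.
split=> [x [/GA//|->//]|g ginj].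
have [|h bh hg] := extG g.
  by move=> x y Gx Gy; apply: ginj; left.
pose a : A := SigSub (mem_set Ae).
(* By injectivity of [h] and [g], neither [h a] nor [g a] is a value on [G]. *)
exists (transposition (h a) (g a) \o h).
  by apply: bij_comp bh; apply: inv_bij; exact: transpositionK.
move=> x /= [Gx|xe]; last first.
  have -> : x = a by exact: val_inj.
  by rewrite transpositionL.
have xa : x <> a by move=> xa; apply: nGe; move: Gx; rewrite xa.
rewrite transpositionD; first exact: hg.
  by move=> /(bij_inj bh).
by rewrite hg// => gxa; apply: xa; apply: ginj gxa; [left|right].
Qed.

Definition inclusion {T : Type} {C A : set T} (CA : C `<=` A) (x : C) : A :=
  SigSub (mem_set (CA _ (set_valP x))).

Lemma inclusion_inj {T : Type} {C A : set T} (CA : C `<=` A) :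
  injective (inclusion CA).
Proof. by move=> x y /(congr1 val) xy; apply: val_inj. Qed.

Lemma injection_extends {T : Type} {A B : set T} (BA : B `<=` A) (k : B -> A) :
  inductively_finite A -> injective k ->
  exists2 h : A -> A, bijective h & forall y, h (inclusion BA y) = k y.
Proof.
move=> finA kinj.
pose f (x : A) : A :=
  if pselect (B (val x)) is left Bx then k (SigSub (mem_set Bx)) else x.
have fE y : f (inclusion BA y) = k y.
  rewrite /f; case: pselect => [By|[]]; last exact: (set_valP y).
  by congr k; exact: val_inj.
have inclE (x : A) : B (val x) -> exists y, x = inclusion BA y.
  by move=> Bx; exists (SigSub (mem_set Bx)); apply: val_inj.
have [|h bh hf] := injective_on_extends f finA BA.
  move=> x x' /inclE[y ->] /inclE[y' ->].
  by rewrite !fE => /kinj ->.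
by exists h => // y; rewrite hf ?fE//; exact: (set_valP y).
Qed.

(** * Permutations of a disjoint union *)

(** The inverse bijections [p] and [q] present [X] as the disjoint union of [Y]
    and [Z]. *)
Definition extend_by_id {X Y Z : Type} (p : Y + Z -> X) (q : X -> Y + Z)
    (s : Z -> Z) (x : X) : X :=
  if q x is inr z then p (inr (s z)) else x.

Section ExtendById.
Context {X Y Z : Type} {p : Y + Z -> X} {q : X -> Y + Z}.
Hypotheses (pK : cancel p q) (qK : cancel q p).

Lemma extend_by_id_inl s y : extend_by_id p q s (p (inl y)) = p (inl y).
Proof. by rewrite /extend_by_id pK. Qed.

Lemma extend_by_id_inr s z : extend_by_id p q s (p (inr z)) = p (inr (s z)).
Proof. by rewrite /extend_by_id pK. Qed.

Lemma sum_cases (Q : X -> Prop) :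
  (forall y, Q (p (inl y))) -> (forall z, Q (p (inr z))) -> forall x, Q x.
Proof. by move=> Ql Qr x; rewrite -(qK x); case: (q x). Qed.

Lemma extend_by_id_bij s : bijective s -> bijective (extend_by_id p q s).
Proof.
case=> t sK tK; exists (extend_by_id p q t); apply: sum_cases => u;
  by rewrite ?extend_by_id_inl// !extend_by_id_inr ?sK ?tK.
Qed.

Lemma extend_by_id_inj s t :
  extend_by_id p q s =1 extend_by_id p q t -> s = t.
Proof.
move=> st; apply/funext => z.
by have := st (p (inr z)); rewrite !extend_by_id_inr => /(can_inj pK)[].
Qed.

(** An injective map cannot send a point of [Z] to a point of [Y] that is
    already its own image. *)
Lemma injective_fixing_extend_by_id g :
  injective g -> (forall y, g (p (inl y)) = p (inl y)) ->
  exists s, g =1 extend_by_id p q s.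
Proof.
move=> ginj gfix.
have /choice[s gs] z : exists z', g (p (inr z)) = p (inr z').
  case E: (q (g (p (inr z)))) => [y|z']; last by exists z'; rewrite -E qK.
  have : g (p (inr z)) = g (p (inl y)) by rewrite gfix -E qK.
  by move=> /ginj /(can_inj pK).
by exists s; apply: sum_cases => u; rewrite ?extend_by_id_inl ?extend_by_id_inr.
Qed.

(** The permutation inverse to [g] fixes [Y] too, and the map of [Z] that it
    induces is inverse to the one induced by [g]. *)
Lemma bijective_fixing_extend_by_id g :
  bijective g -> (forall y, g (p (inl y)) = p (inl y)) ->
  exists2 s, bijective s & g =1 extend_by_id p q s.
Proof.
move=> bg gfix; have [g' gK g'K] := bg.
have [s gs] := injective_fixing_extend_by_id _ (bij_inj bg) gfix.
have [|t g't] := injective_fixing_extend_by_id _ (can_inj g'K).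
  by move=> y; rewrite -{1}gfix gK.
exists s => //; exists t => z.
  have := gK (p (inr z)); rewrite gs g't !extend_by_id_inr.
  by move=> /(can_inj pK)[].
have := g'K (p (inr z)); rewrite g't gs !extend_by_id_inr.
by move=> /(can_inj pK)[].
Qed.

End ExtendById.

Lemma bijections_sum {X Y Z : Type} (p : Y + Z -> X) : bijective p ->
  (forall k : Y -> X, injective k ->
    exists2 h : X -> X, bijective h & forall y, h (p (inl y)) = k y) ->
  [set h : X -> X | bijective h] #=
  [set k : Y -> X | injective k] `*` [set s : Z -> Z | bijective s].
Proof.
move=> [q pK qK] ext.
(* [e k] is the chosen extension of [k], with [id] as a default value. *)
have /choice[e eP] k : exists h : X -> X, injective k ->
    bijective h /\ forall y, h (p (inl y)) = k y.
  have [/ext[h bh hk]|nk] := pselect (injective k); first by exists h.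
  by exists id.
pose join (ks : (Y -> X) * (Z -> Z)) : X -> X :=
  e ks.1 \o extend_by_id p q ks.2.
have joinY k s y : injective k -> join (k, s) (p (inl y)) = k y.
  by move=> /eP[_ ek]; rewrite /join /= extend_by_id_inl.
apply/card_esym; have /bijPex[j] : exists f, set_bij
    ([set k : Y -> X | injective k] `*` [set s : Z -> Z | bijective s])
    [set h : X -> X | bijective h] f; last exact: pcard_eq j.
exists join; split.
- move=> [k s] [/= /eP[bek _] bs].
  by apply: bij_comp bek _; apply: extend_by_id_bij.
- move=> [k s] [l t]; rewrite !inE => -[/= ki _] [/= li _] E.
  have kl : k = l by apply/funext => y; rewrite -(joinY k s)// E joinY.
  subst l; congr pair; apply: (extend_by_id_inj pK) => x.
  by apply: (bij_inj (eP k ki).1); exact: (congr1 (fun h => h x) E).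
- move=> h /= bh; pose k y := h (p (inl y)).
  have ki : injective k by move=> y y' /(bij_inj bh)/(can_inj pK)[].
  have [[e' eK e'K] ek] := eP k ki.
  have be' : bijective e' by exists (e k).
  (* [e' \o h] fixes [Y], since [h] and [e k] agree there. *)
  have [|s bs hs] :=
      bijective_fixing_extend_by_id pK qK _ (bij_comp be' bh).
    by move=> y /=; rewrite -[h _]/(k y) -ek eK.
  exists (k, s) => //; apply/funext => x.
  by rewrite /join /= -hs /= e'K.
Qed.

(** * Permutations of a set and of the complement of a subset *)

Lemma subset_sum_bij {T : Type} {A B : set T} (BA : B `<=` A) :
  bijective (fun u : B + (A `\` B) =>
    match u with
    | inl y => inclusion BA y
    | inr z => inclusion (@subDsetl _ A B) z
    end).
Proof.
have /choice[q qK] (x : A) : exists u : B + (A `\` B), match u with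
    | inl y => inclusion BA y
    | inr z => inclusion (@subDsetl _ A B) z
    end = x.
  have [Bx|nBx] := pselect (B (val x)).
    by exists (inl (SigSub (mem_set Bx))); exact: val_inj.
  have ABx : (A `\` B) (val x) by split=> //; exact: set_valP.
  by exists (inr (SigSub (mem_set ABx))); exact: val_inj.
exists q => //; apply: inj_can_sym qK _ => -[y|z] [y'|z'].
- by move=> /inclusion_inj ->.
- move=> /(congr1 val) yz.
  by have [_ []] := set_valP z'; rewrite -[\val z']yz; exact: (set_valP y).
- move=> /(congr1 val) zy.
  by have [_ []] := set_valP z; rewrite [\val z]zy; exact: (set_valP y').
- by move=> /inclusion_inj ->.
Qed.

Theorem theorem4p3 (T : Type) (A B : set T) (finA : inductively_finite A)
    (subBA : B `<=` A) :
  bijections A #= injections B A `*` bijections (A `\` B).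
Proof.
apply: bijections_sum (subset_sum_bij subBA) _ => k ki.
exact: injection_extends.
Qed.
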